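(* Let $n\geq 9$ be an integer and let $T$ be a tree of order $n$ that is not (isomorphic to) the star $K_{1,n-1}$. Then $Z_1(T)\geq Z_1(B^3_n)$, with equality if and only if $T$ is (isomorphic to) $B_n^3$.
   Context: All graphs are finite, simple and undirected. The order of a graph is its number of vertices. For a graph $G$, a $1$-nearly independent edge subset of $G$ is a subset $I\subseteq E(G)$ that contains exactly one (unordered) pair of adjacent edges, i.e. exactly one pair of distinct edges of $I$ share a common end-vertex. $Z_1(G)$ denotes the number of $1$-nearly independent edge subsets of $G$. $K_{1,n-1}$ is the star with $n$ vertices. $B^k_n$ (a broom) is the tree of order $n$ obtained from a path $P_k$ of order $k$ by adding $n-k$ new vertices and joining each of them to the same single end-vertex of $P_k$; thus $B^3_n$ is the unique tree of order $n$ with degree sequence $(n-2,2,1,\dots,1)$. *)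

(* Defs.v *)
From mathcomp Require Import all_boot.

Set Implicit Arguments.
Unset Strict Implicit.
Unset Printing Implicit Defensive.

Record sgraph := SGraph {
  vertex :> finType;
  adj : rel vertex;
  adj_sym : symmetric adj;
  adj_irr : irreflexive adj
}.

Definition edges (G : sgraph) : {set {set G}} :=
  [set [set x; y] | x in G, y in G & adj x y].

(* Unordered pairs [set A; B], so each pair of adjacent edges counts once. *)
Definition adjacent_pairs (G : sgraph) (I : {set {set G}})
    : {set {set {set G}}} :=
  [set [set A; B] | A in I, B in I & (A != B) && (A :&: B != set0)].

Definition nearly_independent1 (G : sgraph) (I : {set {set G}}) : bool :=
  (I \subset edges G) && (#|adjacent_pairs I| == 1).

Definition Z1 (G : sgraph) : nat :=
  #|[set I : {set {set G}} | nearly_independent1 I]|.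

Definition isomorphic (G H : sgraph) : Prop :=
  exists2 f : G -> H, bijective f & forall x y, adj (f x) (f y) = adj x y.

Definition connected (G : sgraph) : Prop :=
  0 < #|G| /\ forall x y : G, connect (@adj G) x y.

(* [ucycle] also accepts the sequences [::] and [:: x; y] with x, y adjacent,
   which are not graph cycles; hence the bound 2. *)
Definition acyclic (G : sgraph) : Prop :=
  forall s : seq G, ucycle (@adj G) s -> size s <= 2.

Definition is_tree (G : sgraph) : Prop := connected G /\ acyclic G.

Section CompleteBipartite.
Variables a b : nat.

Definition bipartite_adj (x y : 'I_a + 'I_b) : bool :=
  match x, y with
  | inl _, inr _ | inr _, inl _ => true
  | _, _ => false
  end.

Lemma bipartite_adj_sym : symmetric bipartite_adj.
Proof. by case=> [i|i] [j|j]. Qed.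

Lemma bipartite_adj_irr : irreflexive bipartite_adj.
Proof. by case. Qed.

Definition complete_bipartite : sgraph :=
  SGraph bipartite_adj_sym bipartite_adj_irr.

End CompleteBipartite.

Section Broom.
Variables k n : nat.

(* The vertices inl 0, ..., inl k.-1 form the path, in this order; the n - k
   added vertices are joined to its last vertex. The order is n if k <= n. *)
Definition broom_adj (x y : 'I_k + 'I_(n - k)) : bool :=
  match x, y with
  | inl i, inl j => (i.+1 == j :> nat) || (j.+1 == i :> nat)
  | inl i, inr _ | inr _, inl i => i.+1 == k
  | inr _, inr _ => false
  end.

Lemma broom_adj_sym : symmetric broom_adj.
Proof. by case=> [i|i] [j|j] //=; rewrite orbC. Qed.

Lemma broom_adj_irr : irreflexive broom_adj.
Proof. by case=> [i|i] //=; rewrite orbb gtn_eqF. Qed.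

Definition broom : sgraph := SGraph broom_adj_sym broom_adj_irr.

End Broom.

(* Main.v *)
Require Import Defs.
From mathcomp Require Import all_boot zify.

(** A 1-nearly independent edge subset is a path on three vertices together
    with a matching of the vertices off that path. So if x is a leaf attached
    to y in the subgraph induced by S, sorting the subsets by the role of the
    edge xy gives
      [hosoya S = hosoya (S - x) + hosoya (S - x - y)]
      [z1 S = z1 (S - x) + z1 (S - x - y)
              + the sum over the other neighbours w of y
                of hosoya (S - x - y - w)]
    where [hosoya] counts matchings and [z1] counts 1-nearly independent
    subsets ([hosoya_leaf], [z1_leaf]). These recursions evaluate stars, where
    z1 is 'C(n - 1, 2) ([z1_star]), and brooms, which are stars with one edge
    prolonged, where z1 is (n - 3)^2 + 1 ([z1_broom]).

    Let a tree S of order n be neither a star nor a broom. It has a vertex y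
    all of whose neighbours but one, z, are leaves ([penultimate]). Let L be
    the set of these leaves, and T' the tree that remains when y and L are
    deleted, of order m. Deleting a leaf x of L leaves a tree that is not a
    star, and by the recursion it lowers z1 by
      [z1 T' + (#|L| - 1) * hosoya T' + hosoya (T' - z)].
    Here [hosoya T'] is at least m, [z1 T'] is bounded by induction or is
    'C(m - 1, 2), m is at least 3 because S is not a broom, and
    [hosoya (T' - z)] is at least 2 when #|L| = 1 because S - x is not a star.
    For n >= 9 this loss exceeds 2 * n - 7, the difference between the broom
    values of orders n and n - 1; so z1 S exceeds the broom value by induction
    on n ([tree_bounds]). For n <= 8 the induction runs on weaker explicit
    values, since the broom is not minimal at order 6.

    All of this happens inside one ambient graph, on induced subgraphs given
    by vertex sets; trees are sets built by adding leaves one at a time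
    ([tree_on]), and a connected acyclic graph is such a set as a whole
    ([tree_on_setT]). *)

Set Implicit Arguments.
Unset Strict Implicit.
Unset Printing Implicit Defensive.

(** * Counting sets of edges by their adjacent pairs *)

Section SubsetCount.
Variable V : finType.
Implicit Types (E I : {set V}) (P : pred {set V}).

Lemma card_subsets_with v E P : v \in E ->
  #|[set I : {set V} | [&& I \subset E, v \in I & P I]]| =
  #|[set I : {set V} | (I \subset E :\ v) && P (v |: I)]|.
Proof.
move=> vE; rewrite -[RHS](card_in_imset (f := fun I => v |: I)); last first.
  move=> I J; rewrite !inE !subsetD1 -!andbA => /and3P[_ vI _] /and3P[_ vJ _].
  by move=> eqIJ; rewrite -(setU1K vI) eqIJ setU1K.
apply: eq_card => I; rewrite inE; apply/and3P/imsetP => [[IE vI PI]|[J]].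
  by exists (I :\ v); rewrite ?inE ?setD1K // setSD.
rewrite inE subsetD1 => /andP[/andP[JE _] PJ] ->.
by rewrite subUset sub1set vE JE setU11.
Qed.

Lemma card_subsets_split v E P : v \in E ->
  #|[set I : {set V} | (I \subset E) && P I]| =
  #|[set I : {set V} | (I \subset E :\ v) && P I]| +
  #|[set I : {set V} | (I \subset E :\ v) && P (v |: I)]|.
Proof.
move=> vE; rewrite -card_subsets_with //.
rewrite -(cardsID [set I : {set V} | v \in I]) addnC; congr (_ + _).
  by apply: eq_card => I; rewrite !inE subsetD1 andbCA andbA.
by apply: eq_card => I; rewrite !inE -andbA; congr andb; rewrite andbC.
Qed.
End SubsetCount.

Section EdgeSets.
Variable T : sgraph.
Implicit Types (v u : {set T}) (E I : {set {set T}}).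

Definition meets v u := (v != u) && (v :&: u != set0).
Definition meeting v I := [set u in I | meets v u].
Definition away v E := [set u in E | v :&: u == set0].

Lemma adjacent_pairsP I p :
  reflect (exists u w, [/\ u \in I, w \in I, meets u w & p = [set u; w]])
          (p \in adjacent_pairs I).
Proof.
apply: (iffP imset2P) => [[u w uI]|[u [w [uI wI uw ->]]]].
  by rewrite inE => /andP[wI uw] ->; exists u, w.
by exists u w => //; rewrite inE wI.
Qed.

Lemma meetsC v u : meets v u = meets u v.
Proof. by rewrite /meets eq_sym setIC. Qed.

(** Adding v creates one new pair [set v; u] for each u that meets v, and these
    are told apart from the old pairs by containing v. *)
Lemma card_adjacent_pairs_add v I : v \notin I ->
  #|adjacent_pairs (v |: I)| = #|adjacent_pairs I| + #|meeting v I|.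
Proof.
move=> vI; have vN u : u \in I -> (v == u) = false.
  by move=> uI; apply: contraNF vI => /eqP ->.
rewrite -(card_in_imset (f := fun u => [set v; u]) (D := mem (meeting v I))); last first.
  move=> u w; rewrite !inE => /andP[uI _] /andP[wI _] /setP/(_ u).
  by rewrite !inE eqxx eq_sym vN //= => /esym/eqP.
rewrite -cardsUI [X in _ = _ + X](_ : _ = 0) ?addn0; last first.
  apply/eqP; rewrite cards_eq0; apply/eqP/setP => p; rewrite !inE.
  apply/negP => /andP[/adjacent_pairsP[u [w [uI wI _ ->]]] /imsetP[a _]].
  by move=> /setP/(_ v); rewrite !inE eqxx (vN u) // (vN w).
apply: eq_card => p; rewrite inE; apply/adjacent_pairsP/orP.
  move=> [u [w []]]; rewrite !inE => /predU1P[->|uI] /predU1P[->|wI] uw ->.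
  - by move: uw; rewrite /meets eqxx.
  - by right; apply/imsetP; exists w; rewrite // inE wI.
  - right; apply/imsetP; exists u; first by rewrite inE uI meetsC.
    by rewrite setUC.
  by left; apply/adjacent_pairsP; exists u, w.
case=> [/adjacent_pairsP[u [w [uI wI uw ->]]]|/imsetP[u]].
  by exists u, w; rewrite !inE uI wI !orbT.
by rewrite inE => /andP[uI vu] ->; exists v, u; rewrite !inE eqxx uI orbT.
Qed.

Definition num_with_pairs k E :=
  #|[set I : {set {set T}} | (I \subset E) && (#|adjacent_pairs I| == k)]|.

(** Subsets of [away v E] are the subsets of E not containing v that can be
    enlarged by v without creating a pair: this is where the residual edge sets
    of the recursions come from. *)
Lemma away_free v E I : v != set0 ->
  (I \subset away v E) = (I \subset E :\ v) && (#|meeting v I| == 0).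
Proof.
move=> v0; rewrite cards_eq0; apply/subsetP/andP => [IE|[/subsetP IE /eqP/setP I0] u uI].
  split; first apply/subsetP => u /IE.
    rewrite !inE => /andP[-> uv]; rewrite andbT.
    by apply: contraNneq v0 => uv'; move: uv; rewrite uv' setIid.
  apply/eqP/setP => u; rewrite !inE; apply/negP => /andP[/IE].
  by rewrite inE => /andP[_ /eqP uv]; rewrite /meets uv eqxx andbF.
move: (IE _ uI) (I0 u); rewrite !inE uI /meets [v == u]eq_sym => /andP[-> ->] /=.
by move=> /negbFE.
Qed.

Lemma count0_rec v E : v \in E -> v != set0 ->
  num_with_pairs 0 E = num_with_pairs 0 (E :\ v) + num_with_pairs 0 (away v E).
Proof.
move=> vE v0; rewrite /num_with_pairs (card_subsets_split _ vE); congr (_ + _).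
apply: eq_card => I; rewrite !inE away_free // -andbA.
have [IE|//] := boolP (I \subset _); have vI : v \notin I.
  by apply: contraTN IE => vI; rewrite subsetD1 vI andbF.
by rewrite card_adjacent_pairs_add // addn_eq0 /= andbC.
Qed.

(** A set with exactly one adjacent pair either avoids v, or contains v outside
    its pair, or contains v in its pair; in the last case the partner u is
    unique and the rest is a matching away from both u and v. *)
Lemma count1_rec v E : v \in E -> v != set0 ->
  num_with_pairs 1 E = num_with_pairs 1 (E :\ v) + num_with_pairs 1 (away v E)
              + \sum_(u in meeting v E) num_with_pairs 0 (away u (away v E)).
Proof.
move=> vE v0; rewrite /num_with_pairs (card_subsets_split _ vE) -addnA; congr (_ + _).
(* [one u] collects the I in which u is the only edge meeting v; v itself has
   been split off. *)
pose one u := [set I : {set {set T}} | [&& I \subset u |: away v E, u \in I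
                                       & #|adjacent_pairs I| == 0]].
transitivity (\sum_(I : {set {set T}})
  (((I \subset away v E) && (#|adjacent_pairs I| == 1))
   + \sum_(u in meeting v E) (I \in one u))).
  rewrite -sum1dep_card big_mkcond; apply: eq_bigr => I _.
  have oneE u : u \in meeting v E ->
     (I \in one u) = [&& I \subset E :\ v, #|adjacent_pairs I| == 0
                      & meeting v I == [set u]].
    rewrite !inE => /andP[uE vu]; rewrite andbA [RHS]andbCA [in RHS]andbC.
    congr (_ && _); apply/andP/andP => [[/subsetP IE uI]|[/subsetP IE /eqP mI]].
      have uv : u != v by move: vu; rewrite /meets eq_sym => /andP[].
      split; first apply/subsetP => w /IE.
        rewrite !inE => /predU1P[->|/andP[wE vw]]; first by rewrite uv.
        rewrite wE andbT; apply: contraNneq v0 => wv.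
        by move: vw; rewrite wv setIid.
      apply/eqP/setP => w; rewrite !inE; apply/andP/eqP => [[/IE]|->//].
      rewrite !inE => /predU1P[//|/andP[_ /eqP vw]].
      by rewrite /meets vw eqxx andbF.
    split; last by have := set11 u; rewrite -mI inE => /andP[].
    apply/subsetP => w wI; move: (IE _ wI); rewrite !inE => /andP[wv ->] /=.
    have /setP/(_ w) := mI; rewrite !inE wI /= /meets eq_sym wv /=.
    by case: (w == u) => //= /negbFE.
  rewrite (eq_bigr _ (fun u uM => congr1 nat_of_bool (oneE u uM))) away_free //.
  have [IE|] /= := boolP (I \subset _); last by rewrite big1.
  have vI : v \notin I.
    by apply: contraTN IE => vI; rewrite subsetD1 vI andbF.
  rewrite card_adjacent_pairs_add //.
  case: (#|adjacent_pairs I|) => [|[|k]] /=; last first.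
  - by rewrite andbF big1.
  - rewrite andbT big1 // addn0 add1n eqSS; by case: eqP.
  rewrite andbF !add0n; case: (boolP (_ == 1)) => [/cards1P[u mI]|n1].
    rewrite (bigD1 u) /=; last first.
      have := set11 u; rewrite -mI !inE => /andP[/(subsetP IE)] + ->.
      by rewrite !inE => /andP[_ ->].
    rewrite mI eqxx big1 // => w /andP[_ wu].
    by rewrite (inj_eq set1_inj) eq_sym (negbTE wu).
  rewrite big1 // => u _; case: eqP => // mI.
  by rewrite mI cards1 in n1.
rewrite big_split /=; congr (_ + _).
  rewrite -sum1dep_card [RHS]big_mkcond; by apply: eq_bigr => I _; case: (_ && _).
rewrite exchange_big; apply: eq_bigr => u; rewrite inE => /andP[uE vu].
have u0 : u != set0.
  by apply: contraTneq vu => ->; rewrite /meets setI0 eqxx andbF.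
have uA : u \notin away v E.
  by rewrite inE; apply: contraTN vu => /andP[_ /eqP uv]; rewrite /meets uv eqxx andbF.
transitivity #|one u|.
  rewrite -sum1_card [RHS]big_mkcond; by apply: eq_bigr => I _; case: (_ \in _).
rewrite card_subsets_with ?setU11 // setU1K //.
apply: eq_card => I; rewrite !inE (@away_free u) // -andbA.
have -> : away v E :\ u = away v E by apply/setDidPl; rewrite disjoint_sym disjoints1.
have [IE|//] := boolP (I \subset _).
rewrite card_adjacent_pairs_add; last by apply: contraNN uA; apply/subsetP.
by rewrite addn_eq0 /= andbC.
Qed.

End EdgeSets.

(** * Recursions at a leaf, stars and brooms *)

Section VertexSets.
Variable T : sgraph.
Implicit Types (S A B : {set T}) (x y z c : T).

Definition edges_in S := [set e in edges T | e \subset S].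
Definition hosoya S := num_with_pairs 0 (edges_in S).
Definition z1 S := num_with_pairs 1 (edges_in S).
Definition nbrs S x := [set w in S | adj x w].
Definition leaf S x y := (x \in S) && (nbrs S x == [set y]).

Lemma edges_inP S e :
  reflect (exists x y, [/\ x \in S, y \in S, adj x y & e = [set x; y]])
          (e \in edges_in S).
Proof.
rewrite inE; apply: (iffP andP) => [[/imset2P[x y _ + ->]]|[x [y [xS yS xy ->]]]].
  by rewrite inE /= subUset !sub1set => xy /andP[xS yS]; exists x, y.
split; last by rewrite subUset !sub1set xS.
by apply/imset2P; exists x y; rewrite ?inE.
Qed.

Lemma edges_in_setT : edges_in setT = edges T.
Proof. by apply/setP => e; rewrite inE subsetT andbT. Qed.

Lemma mem_edge S x y : x \in S -> y \in S -> adj x y -> [set x; y] \in edges_in S.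
Proof. by move=> xS yS xy; apply/edges_inP; exists x, y. Qed.

Lemma pair_neq0 x y : [set x; y] != set0.
Proof. by apply/set0Pn; exists x; rewrite set21. Qed.

Lemma adj_neq x y : adj x y -> x != y.
Proof. by apply: contraTneq => ->; rewrite adj_irr. Qed.

(** Isolated vertices may be discarded, as both counts depend on the edges
    only. *)
Lemma eq_edges_in A B : B \subset A ->
  (forall u v, u \in A -> v \in A -> adj u v -> u \in B) ->
  edges_in A = edges_in B.
Proof.
move=> /subsetP BA AB; apply/setP => e.
apply/edges_inP/edges_inP => -[u [v [uS vS uv ->]]]; exists u, v.
  by split=> //; [apply: AB uv|apply: AB vS uS _; rewrite adj_sym].
by split=> //; apply: BA.
Qed.

Lemma away_edge S x y : away [set x; y] (edges_in S) = edges_in (S :\ x :\ y).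
Proof.
apply/setP => e; rewrite !inE -andbA; congr andb.
by rewrite !subsetD1 -andbA; congr andb; rewrite setIUl setU_eq0 !setI_eq0 !disjoints1.
Qed.

Lemma leafP S x y : leaf S x y ->
  [/\ x \in S, y \in S, adj x y & forall w, w \in S -> adj x w -> w = y].
Proof.
move=> /andP[xS /eqP/setP N]; have := N y; rewrite !inE eqxx => /andP[yS xy].
by split=> // w wS xw; have := N w; rewrite !inE wS xw => /esym/eqP.
Qed.

Lemma leafI S x y : x \in S -> y \in S -> adj x y ->
  (forall w, w \in S -> adj x w -> w = y) -> leaf S x y.
Proof.
move=> xS yS xy N; rewrite /leaf xS; apply/eqP/setP => w; rewrite !inE.
by apply/andP/eqP => [[wS /N->//]|->].
Qed.

Lemma edges_in_leaf S x y : leaf S x y ->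
  edges_in S :\ [set x; y] = edges_in (S :\ x).
Proof.
move=> /leafP[xS yS xy N]; apply/setP => e; rewrite !inE subsetD1.
rewrite andbCA; case: (boolP (_ \in edges T)) => //= eT.
case: (boolP (_ \subset S)) => eS; rewrite ?andbF // andbT.
have /edges_inP[u [v [uS vS uv ->]]] : e \in edges_in S by rewrite inE eT.
rewrite !inE; apply/idP/idP; last first.
  by apply: contraNneq => /setP/(_ x); rewrite !inE eqxx => ->.
apply: contraNN => /orP[]/eqP xE; rewrite xE.
  by rewrite [v]N // xE.
by rewrite [u]N // ?xE 1?adj_sym // setUC.
Qed.

Lemma hosoya_leaf S x y : leaf S x y ->
  hosoya S = hosoya (S :\ x) + hosoya (S :\ x :\ y).
Proof.
move=> lxy; have [xS yS xy _] := leafP lxy.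
rewrite /hosoya (count0_rec (mem_edge xS yS xy)) ?pair_neq0 //.
by rewrite edges_in_leaf // away_edge.
Qed.

(** The partners of the edge xy in a pair are the edges yw with w <> x, since x
    is a leaf. *)
Lemma z1_leaf S x y : leaf S x y ->
  z1 S = z1 (S :\ x) + z1 (S :\ x :\ y)
         + \sum_(w in nbrs S y :\ x) hosoya (S :\ x :\ y :\ w).
Proof.
move=> lxy; have [xS yS xy N] := leafP lxy.
rewrite /z1 (count1_rec (mem_edge xS yS xy)) ?pair_neq0 //.
rewrite edges_in_leaf // away_edge; congr (_ + _).
have -> : meeting [set x; y] (edges_in S) =
          [set [set y; w] | w in nbrs S y :\ x].
  apply/setP => e; rewrite inE; apply/andP/imsetP => [[/edges_inP]|[w]].
    move=> [u [v [uS vS uv ->]]] /andP[ne /set0Pn[a]].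
    have xuv w : [set x; y] != [set x; w] -> adj x w -> w \in S -> False.
      by move=> + xw wS; rewrite (N w wS xw) eqxx.
    rewrite !inE => /andP[/orP[]/eqP-> {a}] /orP[]/eqP aE; subst.
    - by case: (xuv v).
    - by case: (xuv u); rewrite // 1?[[set _; u]]setUC // adj_sym.
    - exists v => //; rewrite !inE vS uv !andbT.
      by apply: contraNneq ne => ->; rewrite setUC.
    exists u; last by rewrite setUC.
    rewrite !inE uS adj_sym uv !andbT.
    by apply: contraNneq ne => ->.
  rewrite 2!inE => /andP[wx]; rewrite inE => /andP[wS yw] ->.
  split; first exact: mem_edge.
  rewrite /meets; apply/andP; split; last first.
    by apply/set0Pn; exists y; rewrite !inE eqxx orbT.
  apply/eqP => /setP/(_ w); rewrite !inE (negbTE wx) eqxx orbT.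
  by rewrite eq_sym (negbTE (adj_neq yw)).
rewrite big_imset /=; last first.
  move=> u w; rewrite !inE => /and3P[_ _ yu] /and3P[_ _ yw] /setP/(_ u).
  by rewrite !inE eqxx orbT eq_sym (negbTE (adj_neq yu)) => /esym/eqP.
apply: eq_bigr => w _; rewrite away_edge /hosoya; congr (num_with_pairs 0 (edges_in _)).
by apply/setP => u; rewrite !inE; case: (u == y); rewrite ?andbF.
Qed.

Lemma hosoya_gt0 S : 0 < hosoya S.
Proof.
apply/card_gt0P; exists set0; rewrite inE sub0set cards_eq0.
by apply/eqP/setP => p; rewrite inE; apply/adjacent_pairsP => -[u [w []]]; rewrite inE.
Qed.

Lemma hosoya_gt1 S x y : x \in S -> y \in S -> adj x y -> 1 < hosoya S.
Proof.
move=> xS yS xy; rewrite /hosoya (count0_rec (mem_edge xS yS xy)) ?pair_neq0 //.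
rewrite away_edge; have := hosoya_gt0 (S :\ x :\ y); rewrite /hosoya.
suff: 0 < num_with_pairs 0 (edges_in S :\ [set x; y]) by lia.
apply/card_gt0P; exists set0; rewrite inE sub0set cards_eq0.
by apply/eqP/setP => p; rewrite inE; apply/adjacent_pairsP => -[u [w []]]; rewrite inE.
Qed.

Definition edgeless S := [forall x in S, forall y in S, ~~ adj x y].

Lemma edgelessP S : reflect {in S &, forall x y, ~~ adj x y} (edgeless S).
Proof.
apply: (iffP forall_inP) => [eS x y xS yS|eS x xS].
  by move/forall_inP: (eS x xS); apply.
by apply/forall_inP => y yS; apply: eS.
Qed.

Lemma edgeless_counts S : edgeless S -> hosoya S = 1 /\ z1 S = 0.
Proof.
move=> /edgelessP S0; have E0 : edges_in S = set0.
  apply/setP => e; rewrite in_set0; apply/edges_inP => -[x [y [xS yS xy _]]].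
  by have := S0 _ _ xS yS; rewrite xy.
have A0 : adjacent_pairs (set0 : {set {set T}}) = set0.
  by apply/setP => p; rewrite inE; apply/adjacent_pairsP => -[u [w []]]; rewrite inE.
rewrite /hosoya /z1 /num_with_pairs E0; split.
  apply/eqP/cards1P; exists set0; apply/setP => I; rewrite !inE subset0.
  by case: eqP => // ->; rewrite A0 cards0.
apply/eqP; rewrite cards_eq0; apply/eqP/setP => I; rewrite !inE subset0.
by case: eqP => // ->; rewrite A0 cards0.
Qed.

Lemma edgelessPn S : ~~ edgeless S ->
  exists x y, [/\ x \in S, y \in S & adj x y].
Proof.
by move=> /forall_inPn[x xS /forall_inPn[y yS]] /negPn xy; exists x, y.
Qed.

Definition star_at c S :=
  (c \in S) && [forall u in S, forall v in S, adj u v == (u == c) (+) (v == c)].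

Lemma star_atP c S :
  reflect (c \in S /\ {in S &, forall u v, adj u v = (u == c) (+) (v == c)})
          (star_at c S).
Proof.
apply: (iffP andP) => -[cS cP]; split=> //.
  by move=> u v uS vS; move/forall_inP/(_ _ uS)/forall_inP/(_ _ vS)/eqP: cP.
by apply/forall_inP=> u uS; apply/forall_inP=> v vS; rewrite cP.
Qed.

Lemma star_atS c S x : star_at c S -> x != c -> star_at c (S :\ x).
Proof.
move=> /star_atP[cS cP] xc; apply/star_atP; split.
  by rewrite !inE eq_sym xc.
by move=> u v; rewrite !inE => /andP[_ uS] /andP[_ vS]; apply: cP.
Qed.

Lemma star_center_removed c S A : star_at c S -> A \subset S -> c \notin A -> edgeless A.
Proof.
move=> /star_atP[cS cP] /subsetP AS cA; apply/edgelessP => u v uA vA.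
rewrite cP ?AS //.
by rewrite !(negbTE (memPn cA _ _)).
Qed.

(** A leaf edge forms one pair with each other edge of the star, and no edge is
    left off such a pair; so removing a leaf loses #|S| - 2 subsets. *)
Lemma z1_star c S : star_at c S -> z1 S = 'C(#|S|.-1, 2).
Proof.
have [n] := ubnP #|S|; elim: n S => // n IH S Sn cS.
have [cin cP] := star_atP _ _ cS.
have [/eqP S1|] := eqVneq #|S :\ c| 0.
  have -> : #|S|.-1 = 0 by rewrite (cardsD1 c) cin; move: S1; lia.
  case: (@edgeless_counts S) => // ; apply/edgelessP => u v uS vS.
  have eqc w : w \in S -> w = c.
    move=> wS; apply/eqP; move: S1; rewrite cards_eq0 => /eqP/setP/(_ w).
    by rewrite !inE wS andbT => /negbFE.
  by rewrite (eqc u) // (eqc v) // adj_irr.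
rewrite -lt0n => /card_gt0P[x]; rewrite !inE => /andP[xc xS].
have lxc : leaf S x c.
  apply: leafI => // [|w wS]; first by rewrite cP // eqxx (negbTE xc).
  by rewrite cP // (negbTE xc) => /eqP.
have cx := star_atS cS xc.
have card_S : #|S| = #|S :\ x|.+1 by rewrite (cardsD1 x) xS.
have sub0 : S :\ x :\ c \subset S by apply/subsetP => u; rewrite !inE => /and3P[].
rewrite (z1_leaf lxc) (IH _ _ cx); last by move: Sn; rewrite card_S.
have [_ ->] : hosoya (S :\ x :\ c) = 1 /\ z1 (S :\ x :\ c) = 0.
  by apply/edgeless_counts/(star_center_removed cS sub0); rewrite !inE eqxx.
rewrite (eq_bigr (fun => 1)) => [|w _]; last first.
  by case: (@edgeless_counts (S :\ x :\ c :\ w)) => //;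
     apply: (star_center_removed cS); rewrite ?(subset_trans (subD1set _ _)) //
            !inE eqxx andbF.
rewrite sum1_card addn0.
have -> : nbrs S c :\ x = S :\ x :\ c.
  apply/setP => w; rewrite !inE.
  have [wS|] := boolP (w \in S); last by rewrite !andbF.
  by rewrite cP // eqxx andbT /= andbC.
have := cardsD1 c (S :\ x); rewrite 2!inE cin eq_sym xc /= card_S /= => ->.
by rewrite add1n /= binS bin1 addnC.
Qed.

Lemma bin2_succ_add k : 'C(k.+1, 2) + 'C(k, 2) = k ^ 2.
Proof.
elim: k => // k IH; rewrite binS bin1 -mulnn.
by move: IH; rewrite binS bin1 -mulnn; lia.
Qed.

(** A star centred at c to one of whose leaves, y, a further vertex x is
    attached; x, y, c is the path of the broom. *)
Definition broom_at x y c S := [&& leaf S x y, star_at c (S :\ x) & y != c].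

(** Both S - x and S - x - y are stars centred at c, and the only pair that
    contains xy is completed by yc. *)
Lemma z1_broom x y c S : broom_at x y c S -> z1 S = (#|S| - 3) ^ 2 + 1.
Proof.
move=> /and3P[lxy cx yc]; have [xS yS xy N] := leafP lxy.
have yx : y != x by rewrite eq_sym adj_neq.
have [cin cP] := star_atP _ _ cx.
have cxy : star_at c (S :\ x :\ y) by apply: star_atS.
have eN : nbrs S y :\ x = [set c].
  apply/setP => w; rewrite !inE.
  have [->|wx] /= := eqVneq w x; first by move: cin; rewrite !inE eq_sym; case: eqP.
  have [wS|wS] := boolP (w \in S).
    by rewrite cP ?inE ?wx ?yx // (negbTE yc).
  by apply/esym/eqP => wc; move: cin wS; rewrite wc inE => /andP[_ ->].
rewrite (z1_leaf lxy) (z1_star cx) (z1_star cxy) eN big_set1.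
have [-> _] : hosoya (S :\ x :\ y :\ c) = 1 /\ z1 (S :\ x :\ y :\ c) = 0.
  apply/edgeless_counts/(star_center_removed cxy); rewrite ?subD1set //.
  by rewrite !inE eqxx.
have cS2 : c \in S :\ x :\ y by case/andP: cxy.
have -> : #|S| = #|S :\ x :\ y :\ c|.+3.
  by rewrite (cardsD1 x) xS (cardsD1 y) !in_setD1 yx yS (cardsD1 c) cS2.
have -> : #|S :\ x| = #|S :\ x :\ y :\ c|.+2.
  by rewrite (cardsD1 y) in_setD1 yx yS (cardsD1 c) cS2.
have -> : #|S :\ x :\ y| = #|S :\ x :\ y :\ c|.+1.
  by rewrite (cardsD1 c) cS2.
by rewrite /= !subSS subn0 bin2_succ_add.
Qed.

End VertexSets.

(** * Trees built from leaves *)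

Section Trees.
Variable T : sgraph.
Implicit Types (S A B : {set T}) (x y z c : T).

(** Induction on this presentation replaces arguments on paths and cycles. *)
Inductive tree_on : {set T} -> Prop :=
| tree_one x : tree_on [set x]
| tree_add S x y : tree_on S -> x \notin S -> nbrs S x = [set y] ->
    tree_on (x |: S).

Lemma nbrsP S x y w : nbrs S x = [set y] -> w \in S -> adj x w = (w == y).
Proof. by move=> /setP/(_ w); rewrite !inE => + wS; rewrite wS. Qed.

Lemma nbrs1_in S x y : nbrs S x = [set y] -> y \in S /\ adj x y.
Proof. by move=> /setP/(_ y); rewrite !inE eqxx => /andP[]. Qed.

Lemma tree_neq0 S : tree_on S -> 0 < #|S|.
Proof.
by case=> [x|{}S x y _ _ _]; apply/card_gt0P; exists x; rewrite !inE eqxx.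
Qed.

(** The form in which the bounds use that a tree is connected. *)
Lemma tree_isolated S x : tree_on S -> x \in S ->
  (forall w, w \in S -> ~~ adj x w) -> S = [set x].
Proof.
move=> tS; elim: tS x => [a x|{}S a b tS IH aS Na x]; first by rewrite inE => /eqP->.
have [bS ab] := nbrs1_in Na.
rewrite !inE => /predU1P[-> /(_ b)|xS xN]; first by rewrite !inE bS orbT ab => /(_ isT).
have Sx : S = [set x] by apply: IH => // w wS; apply: xN; rewrite !inE wS orbT.
have bx : b = x by apply/set1P; rewrite -Sx.
by have := xN a (setU11 _ _); rewrite adj_sym -bx ab.
Qed.

(** The leaf removed need not be the last one added; the delicate case is that
    of a leaf to which the last vertex was attached, when S has only these two
    vertices. *)
Lemma tree_remove_leaf S x y : tree_on S -> leaf S x y -> tree_on (S :\ x).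
Proof.
move=> tS; elim: tS x y => [a x y|{}S a b tS IH aS Na x y] /leafP[].
  by rewrite !inE => /eqP-> /eqP-> ; rewrite adj_irr.
have [bS ab] := nbrs1_in Na.
rewrite [x \in _]in_setU1 => /predU1P[->|xS yS xy N]; first by rewrite setU1K.
have ax : a != x by apply: contraNneq aS => ->.
have [xb|xb] := eqVneq x b.
  have ya : y = a by apply/esym/N; rewrite ?setU11 // xb adj_sym.
  suff -> : S = [set x].
    suff -> : (a |: [set x]) :\ x = [set a] by exact: tree_one.
    apply/setP => w; rewrite !inE; have [->|] := eqVneq w x; last by rewrite orbF.
    by rewrite eq_sym (negbTE ax).
  apply: tree_isolated => // w wS; apply/negP => xw.
  by have := N w; rewrite !inE wS orbT ya => /(_ isT xw) wa; rewrite -wa wS in aS.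
have yS' : y \in S.
  move: yS; rewrite in_setU1 => /predU1P[|//] ya; move: xy.
  by rewrite ya adj_sym (nbrsP Na) // (negbTE xb).
have -> : (a |: S) :\ x = a |: (S :\ x).
  apply/setP => w; rewrite !inE; case: eqP => //= ->.
  by rewrite eq_sym (negbTE ax).
apply: (@tree_add _ a b).
- apply: (IH x y); apply: leafI => // w wS; apply: N.
  by rewrite inE wS orbT.
- by rewrite !inE (negbTE aS) andbF.
apply/setP => w; rewrite !inE; have [wS|wS] := boolP (w \in S).
  rewrite andbT (nbrsP Na) //; case: eqVneq => //= ->.
  by rewrite (negbTE xb).
by rewrite andbF; apply/esym/eqP => wb; rewrite wb bS in wS.
Qed.

Lemma tree_leaf S : tree_on S -> 1 < #|S| -> exists x y, leaf S x y.
Proof.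
case=> [x|{}S x y _ xS Nx _]; first by rewrite cards1.
have [yS xy] := nbrs1_in Nx.
exists x, y; apply: leafI; rewrite ?setU11 ?inE ?yS ?orbT //.
move=> w; rewrite in_setU1 => /predU1P[->|wS]; first by rewrite adj_irr.
by rewrite (nbrsP Nx) // => /eqP.
Qed.

Lemma tree_remove_leaves S A : tree_on S ->
  {in A, forall a, exists2 b, leaf S a b & b \notin A} -> tree_on (S :\: A).
Proof.
have [n] := ubnP #|A|; elim: n S A => // n IH S A An tS lA.
have [->|[a aA]] := set_0Vmem A; first by rewrite setD0.
have [b lab bA] := lA _ aA.
have -> : S :\: A = (S :\ a) :\: (A :\ a).
  by apply/setP => w; rewrite !inE; case: eqP => // ->; rewrite aA.
apply: IH; first by move: An; rewrite (cardsD1 a) aA.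
  exact: tree_remove_leaf lab.
move=> w; rewrite !inE => /andP[wa wA].
have [v /leafP[wS vS wv N] vA] := lA _ wA; exists v; last by rewrite inE (negbTE vA) andbF.
apply: leafI => //; rewrite ?inE ?wa //.
  by rewrite vS andbT; apply: contraNneq vA => ->.
by move=> u /setD1P[_ uS]; apply: N.
Qed.

Lemma tree_adjacent_leaves S x y : tree_on S -> leaf S x y -> leaf S y x ->
  S = [set x; y].
Proof.
move=> tS lxy /leafP[yS xS yx N]; rewrite -(setD1K xS); congr (_ |: _).
have tx := tree_remove_leaf tS lxy.
apply: tree_isolated => //; first by rewrite !inE yS andbT adj_neq.
by move=> w /setD1P[wx wS]; apply: contraNN wx => yw; rewrite (N w).
Qed.

(** In a tree of order at least 2 no vertex is isolated, so if every edge passes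
    through c, all other vertices are adjacent to c. *)
Lemma tree_star S c : tree_on S -> c \in S -> edgeless (S :\ c) -> star_at c S.
Proof.
move=> tS cS /edgelessP eS; apply/star_atP; split=> // u v uS vS.
have cadj w : w \in S -> w != c -> adj w c.
  move=> wS wc; apply/negPn/negP => wNc.
  suff Sw : S = [set w] by move: cS; rewrite Sw inE eq_sym (negbTE wc).
  apply: tree_isolated => // a aS; have [->//|ac] := eqVneq a c.
  by apply: eS; rewrite !inE ?wc ?ac.
have [->|uc] := eqVneq u c; have [->|vc] := eqVneq v c => /=.
- by rewrite adj_irr.
- by rewrite adj_sym cadj.
- by rewrite cadj.
by apply/negbTE/eS; rewrite !inE ?uc ?vc.
Qed.

Definition is_star S := [exists c, star_at c S].

Lemma is_starPn S c : tree_on S -> ~~ is_star S -> c \in S ->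
  exists x y, [/\ x \in S :\ c, y \in S :\ c & adj x y].
Proof.
move=> tS nS cS; apply: edgelessPn; apply: contraNN nS => e.
by apply/existsP; exists c; apply: tree_star.
Qed.

(** The tree left after deleting all leaves of S has at least two vertices when
    S is not a star, and any leaf of it can serve as y, with z its remaining
    neighbour. The vertex q records that z still has a neighbour once y and its
    leaves are gone. *)
Lemma penultimate S : tree_on S -> ~~ is_star S ->
  exists y z (L : {set T}),
  [/\ y \in S, L != set0, nbrs S y = z |: L, z \notin L &
     [/\ {in L, forall x, leaf S x y}, tree_on (S :\: L :\ y),
         z \in S :\: L :\ y & exists2 q, q \in S :\: L :\ y & adj z q]].
Proof.
move=> tS nS.
pose F := [set x in S | [exists y, leaf S x y]].
have FP x : reflect (exists y, leaf S x y) (x \in F).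
  rewrite inE; apply: (iffP andP) => [[_ /existsP]//|[y l]].
  by split; [case/andP: l|apply/existsP; exists y].
have FN a b : leaf S a b -> b \notin F.
  move=> lab; apply/FP => -[a' lba']; have [aS bS ab _] := leafP lab.
  have aa' : a' = a by case: (leafP lba') => _ _ _ /(_ a aS); rewrite adj_sym => /(_ ab).
  rewrite aa' in lba'; move/negP: nS; apply; apply/existsP; exists a.
  apply: tree_star => //; rewrite (tree_adjacent_leaves tS lab lba').
  apply/edgelessP => u v; rewrite !inE => /andP[/negbTE -> /eqP->].
  by move=> /andP[/negbTE -> /eqP->]; rewrite adj_irr.
have tF : tree_on (S :\: F).
  by apply: tree_remove_leaves => // a /FP[b lab]; exists b => //; apply: FN lab.
have F1 : 1 < #|S :\: F|.
  rewrite ltn_neqAle tree_neq0 // andbT eq_sym; apply: contraNN nS => /cards1P[c cE].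
  have cin : c \in S :\: F by rewrite cE set11.
  have inF u : u \in S -> u != c -> u \in F.
    by move=> uS uc; have /setP/(_ u) := cE; rewrite !inE uS (negbTE uc) andbT => /negbFE.
  case/setDP: cin => cS cF.
  apply/existsP; exists c; apply: tree_star => //; apply/edgelessP => u v.
  move=> /setD1P[uc uS] /setD1P[vc vS]; apply/negP => uv.
  have /FP[b lub] := inF u uS uc; have [_ _ _ N] := leafP lub.
  by have := FN _ _ lub; rewrite -(N v vS uv) inF.
have [y [z lyz]] := tree_leaf tF F1; have [/setDP[yS yF] /setDP[zS zF] yz N] := leafP lyz.
pose L := nbrs S y :&: F; exists y, z, L.
have lL : {in L, forall x, leaf S x y}.
  move=> x; rewrite !inE => /andP[/andP[xS yx] /andP[_ /existsP[w lxw]]].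
  by have [_ _ _ /(_ y yS)] := leafP lxw; rewrite adj_sym => /(_ yx) ->.
have zL : z \notin L by rewrite inE (negbTE zF) andbF.
have yL : y \notin L by rewrite inE (negbTE yF) andbF.
have Ny : nbrs S y = z |: L.
  apply/setP => w; rewrite in_setU1 in_setI; have [wF|wF] := boolP (w \in F).
    by rewrite andbT; case: eqP => // wz; rewrite -wz wF in zF.
  rewrite andbF orbF inE; apply/andP/eqP => [[wS yw]|->//].
  by apply: N => //; apply/setDP.
split=> //.
  apply: contraNneq yF => L0; rewrite L0 setU0 in Ny.
  by apply/FP; exists z; rewrite /leaf yS Ny eqxx.
have zT : z \in S :\: L :\ y by rewrite !in_setD1 in_setD zL zS eq_sym adj_neq.
split=> //.
  apply: (@tree_remove_leaf _ y z).
    by apply: tree_remove_leaves => // a aL; exists y; rewrite // lL.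
  apply: leafI => //; rewrite ?in_setD ?yL ?zL // => w /setDP[wS wL] yw.
  have : w \in nbrs S y by rewrite inE wS.
  by rewrite Ny in_setU1 (negbTE wL) orbF => /eqP.
have : ~~ leaf S z y by apply: contraNN zF => l; apply/FP; exists y.
rewrite /leaf zS /= => /eqP Nz; 
have [q /and3P[qS zq qy]|q] := pickP (fun q => [&& q \in S, adj z q & q != y]).
  exists q => //; rewrite in_setD1 qy in_setD qS andbT /=.
  apply/negP => /lL /leafP[_ _ _ /(_ z zS)]; rewrite adj_sym => /(_ zq) E.
  by move: yz; rewrite E adj_irr.
case: Nz; apply/setP => w; rewrite !inE; have := q w; case: eqVneq => [->|_].
  by rewrite yS adj_sym yz.
by rewrite andbT.
Qed.

(** The empty matching and the single edges are already #|S| matchings. *)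
Lemma hosoya_tree S : tree_on S -> #|S| <= hosoya S.
Proof.
elim=> [x|{}S x y tS IH xS Nx]; first by rewrite cards1 hosoya_gt0.
have [yS xy] := nbrs1_in Nx.
have l : leaf (x |: S) x y.
  apply: leafI; rewrite ?setU11 ?inE ?yS ?orbT //.
  move=> w; rewrite in_setU1 => /predU1P[->|wS]; first by rewrite adj_irr.
  by rewrite (nbrsP Nx) // => /eqP.
rewrite (hosoya_leaf l) setU1K // cardsU1 xS.
have := hosoya_gt0 (S :\ y); lia.
Qed.

End Trees.

(** * The lower bound for trees *)

Section Bounds.
Variable T : sgraph.
Implicit Types (S A B L : {set T}) (x y z c : T).

Definition is_broom S := [exists x, exists y, exists c, broom_at x y c S].

(** If x were attached to the centre of the star, S itself would be a star. *)
Lemma is_broomI S x y : tree_on S -> ~~ is_star S -> leaf S x y ->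
  is_star (S :\ x) -> is_broom S.
Proof.
move=> tS nS lxy /existsP[c cx].
apply/existsP; exists x; apply/existsP; exists y; apply/existsP; exists c.
rewrite /broom_at lxy cx; apply: contraNN nS => /eqP yc; apply/existsP; exists c.
have [xS cS _ N] := leafP lxy; rewrite yc in cS N.
apply: tree_star => //; apply/edgelessP => u v /setD1P[uc uS] /setD1P[vc vS].
have [ux|ux] := eqVneq u x.
  by rewrite ux; apply: contraNN vc => /(N v vS) ->.
have [vx|vx] := eqVneq v x.
  by rewrite vx adj_sym; apply: contraNN uc => /(N u uS) ->.
have /star_atP[_ cP] := cx.
by rewrite cP ?inE ?ux ?vx // (negbTE uc) (negbTE vc).
Qed.

(** Once y is deleted, the leaves in L are isolated, so every term of [z1_leaf]
    can be read off the tree T' = S :\: L :\ y. Among the neighbours of y other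
    than x, those in L give hosoya T', and z gives the last term. *)
Lemma z1_remove_pendant S y z L x :
  nbrs S y = z |: L -> z \notin L -> {in L, forall a, leaf S a y} -> x \in L ->
  z1 S = z1 (S :\ x) + z1 (S :\: L :\ y)
         + (#|L|.-1 * hosoya (S :\: L :\ y) + hosoya (S :\: L :\ y :\ z)).
Proof.
move=> Ny zL lL xL; have lxy := lL x xL; have [xS yS _ _] := leafP lxy.
have yL : y \notin L by apply/negP => /lL /leafP[_ _]; rewrite adj_irr.
have E A B : A = S :\ y :\: B -> B \subset L ->
  forall D, edges_in (A :\: D) = edges_in (S :\: L :\ y :\: D).
  move=> -> /subsetP BL D; apply: eq_edges_in.
    apply/subsetP => w; rewrite !in_setD !in_set1 => /and4P[-> -> wL ->].
    by rewrite !andbT; apply: contraNN wL; apply: BL.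
  move=> u v; rewrite !in_setD !in_set1 => /and4P[-> _ -> uS] /and4P[_ _ vy vS] uv.
  rewrite uS andbT /=; apply/negP => /lL /leafP[_ _ _ /(_ v vS uv)] vE.
  by rewrite vE eqxx in vy.
have Exy D : edges_in (S :\ x :\ y :\: D) = edges_in (S :\: L :\ y :\: D).
  apply: (E _ [set x]); last by rewrite sub1set.
  by apply/setP => w; rewrite !inE andbCA.
rewrite (z1_leaf lxy) Ny; congr (_ + _ + _).
  by have := Exy set0; rewrite !setD0 /z1 => ->.
have -> : (z |: L) :\ x = z |: (L :\ x).
  apply/setP => w; rewrite !inE; case: (eqVneq w z) => //= ->.
  by rewrite andbT; apply: contraNneq zL => ->.
rewrite big_setU1 ?inE ?(negbTE zL) ?andbF //= addnC; congr (_ + _); last first.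
  by rewrite /hosoya Exy.
rewrite (eq_bigr (fun => hosoya (S :\: L :\ y))) => [|w /setD1P[wx wL]].
  by rewrite sum_nat_const; congr (_ * _); rewrite (cardsD1 x L) xL.
have := E (S :\ x :\ y :\ w) [set x; w] _ _ set0; rewrite !setD0 /hosoya => -> //.
  by apply/setP => u; rewrite !inE negb_or; case: (u == x); case: (u == y); case: (u == w).
by rewrite subUset !sub1set xL.
Qed.

(** The broom value, except at 6 and 7. At order 6 the spider with legs of
    lengths 2, 2, 1 has value 9, below the 10 of the broom. The bound 16 at
    order 7 is not attained, but it is what the induction yields from 9, and it
    is strong enough for order 8. *)
Definition lower_bound n :=
  match n with 6 => 9 | 7 => 16 | _ => (n - 3) ^ 2 + 1 end.

(** Also valid for stars, as the tree T' left by a pendant star may be one. *)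
Definition tree_lower_bound m := minn 'C(m.-1, 2) (lower_bound m).

Lemma lower_boundE n : 7 < n -> lower_bound n = (n - 3) ^ 2 + 1.
Proof. by do 8![case: n => // n]. Qed.

Lemma tree_lower_bound_linear m : 7 <= m -> 2 * m - 4 <= tree_lower_bound m.
Proof.
move=> m7; rewrite leq_min; apply/andP; split.
  have lin k : 2 * k + 10 <= 'C(k + 6, 2).
    by elim: k => // k IH; rewrite addSn binS bin1; lia.
  by have := lin (m - 7); have -> : m - 7 + 6 = m.-1; lia.
have [->//|m8] := eqVneq m 7; rewrite lower_boundE; last by lia.
by rewrite -mulnn; nia.
Qed.

(** A lower bound for the growth of z1 from order n to n.+1, for a tree that is
    neither star nor broom. The broom values grow by 2 * n - 5; the large value
    at 7 makes up for the weak bound of that order. *)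
Definition pendant_gain n :=
  match n with 4 => 3 | 5 => 4 | 6 => 7 | 7 => 11 | _ => 2 * n - 4 end.

(** Here l is #|L| and m the order of T'; the summand (l == 1) reflects that
    hosoya (T' - z) is at least 2 when y carries a single leaf. *)
Lemma pendant_gainP l m d : 1 <= l -> 3 <= m ->
  tree_lower_bound m + l.-1 * m + 1 + (l == 1) <= d -> pendant_gain (m + l) <= d.
Proof.
move=> l1 m3; have [m7|m7] := leqP 7 m.
  have E : pendant_gain (m + l) = 2 * (m + l) - 4.
    have : 7 < m + l by lia.
    by move: (m + l); do 8![case=> //].
  have := tree_lower_bound_linear m7; rewrite E; case: l l1 {E} => // l _ /=; nia.
case: l l1 => // l _; rewrite addnS /=.
have -> : (l.+1 == 1) = (l == 0) by [].
case: m m3 m7 => [|[|[|[|[|[|[|m]]]]]]] // _ _; rewrite /tree_lower_bound /lower_bound /= !bin2 /=.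
all: do 8![case: l => [|l] //=; try lia].
Qed.

Lemma lower_bound_gain n : 4 <= n ->
  lower_bound n.+1 <= lower_bound n + pendant_gain n /\
  (7 <= n -> (n - 2) ^ 2 + 2 <= lower_bound n + pendant_gain n).
Proof.
case: n => [|[|[|[|[|[|[|[|n]]]]]]]] // _.
rewrite !lower_boundE // /pendant_gain (_ : _ - 4 = 2 * n + 12); last by lia.
by rewrite -!mulnn !subSS !subn0 !mulSn !mulnS; split; lia.
Qed.

(** The strict bound starts at order 8 only: at order 7 the spider with legs of
    lengths 2, 2, 1, 1 has the broom value 17 and is not a broom. *)
Lemma tree_bounds S : tree_on S -> ~~ is_star S ->
  lower_bound #|S| <= z1 S /\
  (~~ is_broom S -> 7 < #|S| -> (#|S| - 3) ^ 2 + 2 <= z1 S).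
Proof.
have [n] := ubnP #|S|; elim: n S => // n IH S Sn tS nS.
have [bS|nB] := boolP (is_broom S).
  split=> //; have [x /existsP[y /existsP[c B]]] := existsP bS.
  rewrite (z1_broom B); case: #|S| => [|[|[|[|[|[|[|[|k]]]]]]]] //.
have [y [z [L [yS L0 Ny zL [lL tT zT [q qT zq]]]]]] := penultimate tS nS.
have [x xL] := set0Pn _ L0; have lxy := lL x xL; have [xS _ _ _] := leafP lxy.
have yL : y \notin L by apply/negP => /lL /leafP[_ _]; rewrite adj_irr.
have nSx : ~~ is_star (S :\ x) by apply: contraNN nB; apply: is_broomI lxy.
have cardSx : #|S| = #|S :\ x|.+1 by rewrite (cardsD1 x) xS.
have [|lbx _] := IH _ _ (tree_remove_leaf tS lxy) nSx; first by rewrite -ltnS -cardSx.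
have cardS : #|S| = #|S :\: L :\ y| + #|L| + 1.
  have LS : L \subset S by apply/subsetP => a /lL /leafP[].
  rewrite -(cardsID L S) (setIidPr LS) (cardsD1 y (S :\: L)) in_setD yL yS /=.
  by rewrite addnCA [RHS]addnC [#|L| + _]addnC.
have rec := z1_remove_pendant Ny zL lL xL.
set T' := S :\: L :\ y in tT zT qT cardS rec.
have inT w : w \in S -> w != y -> w \notin L -> w \in T'.
  by move=> wS wy wL; rewrite !in_setD1 in_setD wS wy wL.
have T'P w : w \in T' -> [/\ w \in S, w != y & w \notin L].
  by rewrite in_setD1 in_setD => /and3P[].
have [zS zy _] := T'P z zT; have [qS qy qL] := T'P q qT.
have cT3 : 3 <= #|T'|.
  (* If T' is just the edge zq, removing q leaves a star centred at y. *)
  rewrite leqNgt; apply: contraNN nB => T2.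
  have T'E : T' = [set z; q].
    apply/esym/eqP; rewrite eqEcard subUset !sub1set zT qT cards2 adj_neq //.
  have lqz : leaf S q z.
    apply: leafI; rewrite // 1?adj_sym // => w wS qw.
    have wL : w \notin L.
      by apply: contraNN qy => /lL/leafP[_ _ _ N]; rewrite (N q) // adj_sym.
    have wy : w != y.
      apply: contraTneq qw => ->; apply/negP; rewrite adj_sym => yq.
      have : q \in nbrs S y by rewrite inE qS.
      by rewrite Ny in_setU1 (negbTE qL) orbF eq_sym (negbTE (adj_neq zq)).
    have := inT w wS wy wL; rewrite T'E in_set2 => /orP[/eqP//|/eqP wq].
    by rewrite wq adj_irr in qw.
  apply: (is_broomI tS nS lqz); apply/existsP; exists y; apply: tree_star.
  - exact: tree_remove_leaf lqz.
  - by rewrite in_setD1 yS eq_sym qy.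
  have outL u v : u \in S :\ q :\ y -> v \in S :\ q :\ y -> adj u v -> u \notin L.
    move=> _ /setD1P[vy /setD1P[_ vS]] uv; apply/negP => /lL/leafP[_ _ _ /(_ v vS uv)].
    by move/eqP: vy.
  have isz u v : u \in S :\ q :\ y -> v \in S :\ q :\ y -> adj u v -> u = z.
    move=> uS vS uv; have := outL _ _ uS vS uv.
    case/setD1P: uS => uy /setD1P[uq uS] uL.
    by have := inT u uS uy uL; rewrite T'E in_set2 (negbTE uq) orbF => /eqP.
  apply/edgelessP => u v uS vS; apply/negP => uv.
  have uz := isz _ _ uS vS uv; have vz : v = z by apply: (isz v u); rewrite // adj_sym.
  by rewrite uz vz adj_irr in uv.
have hT := hosoya_tree tT.
have hz : 1 <= hosoya (T' :\ z) by exact: hosoya_gt0.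
(* If T' - z had no edges and x were the only leaf at y, then z would be the
   centre of a star S - x. *)
have hz2 : #|L| = 1 -> 2 <= hosoya (T' :\ z).
  move=> /eqP/cards1P[x' Lx]; have xx' : x' = x by move: xL; rewrite Lx => /set1P.
  rewrite {x'}xx' in Lx.
  have [] := @is_starPn _ (S :\ x) z (tree_remove_leaf tS lxy) nSx.
    by rewrite in_setD1 zS andbT; apply: contraNneq zL => ->.
  move=> u [v [uS vS uv]].
  have noy a b : a \in S :\ x :\ z -> b \in S :\ x :\ z -> adj a b -> a \in T' :\ z.
    move=> /setD1P[az /setD1P[ax aS]] /setD1P[bz /setD1P[bx bS]] ab.
    rewrite in_setD1 az inT //; last by rewrite Lx inE.
    apply: contraTneq ab => ->; apply/negP => yb.
    have : b \in nbrs S y by rewrite inE bS.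
    by rewrite Ny Lx !inE (negbTE bz) (negbTE bx).
  by apply: (@hosoya_gt1 _ _ u v (noy _ _ uS vS uv) _ uv); apply: (noy v u); rewrite // adj_sym.
have z1T : minn 'C(#|T'|.-1, 2) (lower_bound #|T'|) <= z1 T'.
  have [/existsP[c cT]|nT] := boolP (is_star T'); first by rewrite (z1_star cT) geq_minl.
  have [|] := IH T' _ tT nT.
    by move: Sn; rewrite cardS addn1 ltnS; apply/leq_ltn_trans/leq_addr.
  by move=> le _; rewrite geq_min le orbT.
have L1 : 1 <= #|L| by rewrite card_gt0.
have {}cardSx : #|S :\ x| = #|T'| + #|L|.
  by move: cardSx; rewrite cardS addn1 => -[->].
rewrite rec cardS; rewrite cardSx in lbx.
move: lbx hT hz hz2 z1T L1 cT3.
move: (z1 (S :\ x)) (z1 T') (hosoya T') (hosoya (T' :\ z)) #|L| #|T'|; clear.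
move=> s t h h' l m lbx hm h1 h2 mt l1 m3.
have n4 : 4 <= m + l by lia.
have [gain gain8] := lower_bound_gain n4.
have : pendant_gain (m + l) <= t + (l.-1 * h + h').
  apply: (pendant_gainP l1 m3).
  have := leq_mul (leqnn l.-1) hm; move: mt; rewrite -/(tree_lower_bound _).
  by case: eqP => [/h2|_] /=; lia.
rewrite addn1 -addnA; split; first by lia.
by move=> _ n8; have -> : (m + l).+1 - 3 = m + l - 2 by []; have := gain8 n8; lia.
Qed.

End Bounds.

(** * Trees, stars and brooms up to isomorphism *)

Section TreeGraphs.
Variable T : sgraph.
Implicit Types (S : {set T}) (x y z c : T).

Definition induced_adj S := [rel u v : T | [&& u \in S, v \in S & adj u v]].

Lemma tree_connect S : tree_on S -> {in S &, forall u v, connect (induced_adj S) u v}.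
Proof.
have sym A : connect_sym (induced_adj A).
  by apply: sym_connect_sym => u v /=; rewrite andbCA adj_sym.
elim=> [x u v /set1P-> /set1P->|{}S x y tS IH xS Nx]; first exact: connect0.
have [yS xy] := nbrs1_in Nx.
have toS u : u \in x |: S -> connect (induced_adj (x |: S)) u y.
  rewrite in_setU1 => /predU1P[->|uS].
    by apply: connect1; rewrite /= !inE eqxx yS orbT.
  apply: (connect_sub _ (IH u y uS yS)) => a b /and3P[aS bS ab].
  by apply: connect1; rewrite /= !inE aS bS !orbT.
by move=> u v uS vS; apply: (connect_trans (toS u uS)); rewrite sym toS.
Qed.

(** Two neighbours of x in S are joined by a path inside S, which x would close
    into a cycle. *)
Lemma acyclic_one_neighbour S x y z : acyclic T -> tree_on S -> x \notin S ->
  y \in S -> z \in S -> adj x y -> adj x z -> y = z.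
Proof.
move=> acT tS xS yS zS xy xz; apply/eqP; apply: contraT => yz.
have /connectP[p pP zE] := tree_connect tS yS zS.
case/shortenP: pP zE => {}p pP pU _ zE.
have pS : {subset y :: p <= S}.
  move=> w; rewrite inE => /predU1P[->//|].
  by elim: p y {yS xy yz zE pU} pP => // b p IH a /= /andP[/and3P[_ bS _] pP];
     rewrite inE => /predU1P[->//|]; apply: IH pP.
suff /acT : ucycle (@adj T) [:: x, y & p] by case: p zE {pP pU pS} yz => //= ->; rewrite eqxx.
apply/andP; split; last by rewrite cons_uniq pU andbT; apply: contraNN xS => /pS.
rewrite /= xy rcons_path -zE adj_sym xz andbT.
by apply: sub_path pP => a b /and3P[].
Qed.

(** A tree subset that is not everything can be enlarged: connectedness gives a
    vertex outside it with a neighbour inside, and acyclicity makes this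
    neighbour unique. *)
Lemma tree_on_setT : is_tree T -> tree_on [set: T].
Proof.
case=> -[/card_gt0P[a _] conn] acT.
have grow n S : #|~: S| <= n -> tree_on S -> tree_on [set: T].
  elim: n S => [|n IH] S Sn tS.
    by move: Sn; rewrite leqn0 cards_eq0 => /eqP S0; rewrite -setC0 -S0 setCK.
  have [/existsP[x /existsP[y /and3P[xS yS xy]]]|none] :=
    boolP [exists x, exists y, [&& x \notin S, y \in S & adj x y]].
    apply: (IH (x |: S)).
      by move: Sn; rewrite (cardsD1 x) inE xS setCU setDE setIC.
    apply: (tree_add (y := y)) => //; apply/setP => w; rewrite !inE.
    apply/andP/eqP => [[wS xw]|->//].
    exact: (acyclic_one_neighbour acT tS xS).
  suff -> : [set: T] = S by [].
  have cl : closed (@adj T) (mem S).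
    move=> u v uv; apply/idP/idP => [uS|vS]; apply: contraNT none => nS.
      by apply/existsP; exists v; apply/existsP; exists u; rewrite nS uS adj_sym.
    by apply/existsP; exists u; apply/existsP; exists v; rewrite nS vS.
  have /card_gt0P[b bS] := tree_neq0 tS.
  by apply/setP => w; rewrite in_setT -[RHS](closed_connect cl (conn b w)) bS.
exact: (grow _ _ (leqnn _) (tree_one a)).
Qed.

(** Stars and brooms have vertices of the form 'I_k + 'I_(n - k) in which only
    those of 'I_k are distinguished, so isomorphisms can be built by naming the
    latter. *)
Lemma extend_injection k (g : 'I_k -> T) : injective g ->
  exists2 F : 'I_k + 'I_(#|T| - k) -> T, bijective F & forall i, F (inl i) = g i.
Proof.
move=> gI; have cA : #|~: (g @: 'I_k)| = #|T| - k.
  by rewrite cardsCs setCK card_imset // card_ord.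
have hP (j : 'I_(#|T| - k)) : enum_val (cast_ord (esym cA) j) \notin g @: 'I_k.
  by have := enum_valP (cast_ord (esym cA) j); rewrite inE.
pose F (a : 'I_k + 'I_(#|T| - k)) : T :=
  match a with inl i => g i | inr j => enum_val (cast_ord (esym cA) j) end.
exists F => //; apply: inj_card_bij.
  case=> [i|j] [i'|j'] //= E.
  - by rewrite (gI _ _ E).
  - by have := hP j'; rewrite -E imset_f.
  - by have := hP j; rewrite E imset_f.
  by move/enum_val_inj/cast_ord_inj: E => ->.
rewrite card_sum !card_ord subnKC // -[k]card_ord.
exact: leq_card gI.
Qed.

Lemma isomorphic_from (H : sgraph) (F : H -> T) :
  bijective F -> (forall a b, adj (F a) (F b) = adj a b) -> isomorphic T H.
Proof.
case=> f fK Kf FA; exists f; first by exists F.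
by move=> x y; rewrite -FA !Kf.
Qed.

Lemma star_isomorphic c : star_at c [set: T] ->
  isomorphic T (complete_bipartite 1 #|T|.-1).
Proof.
move=> /star_atP[_ cP]; rewrite -subn1.
have [|F Fb Fc] := @extend_injection 1 (fun => c); first by move=> i j _; rewrite !ord1.
apply: (@isomorphic_from (complete_bipartite 1 (#|T| - 1)) F Fb) => a b.
rewrite cP // -(Fc ord0) !(bij_eq Fb).
by case: a b => [i|i] [j|j]; rewrite ?ord1.
Qed.

Lemma broom_isomorphic x y c : broom_at x y c [set: T] -> isomorphic T (broom 3 #|T|).
Proof.
move=> /and3P[lxy cx yc]; have [_ _ xy N] := leafP lxy.
have [+ cP] := star_atP _ _ cx; rewrite !inE andbT => cx'.
have yx : y != x by rewrite eq_sym adj_neq.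
have adjE u v : adj u v = if u == x then v == y else
                          if v == x then u == y else (u == c) (+) (v == c).
  have xN w : adj x w = (w == y) by apply/idP/eqP => [/N->|->].
  case: eqVneq => [->//|ux]; case: eqVneq => [->|vx]; first by rewrite adj_sym.
  by rewrite cP ?inE ?ux ?vx.
have [|F Fb FE] := @extend_injection 3 (tnth [tuple x; y; c]).
  by apply/tuple_uniqP; rewrite /= !inE negb_or ![x == _]eq_sym yx cx' yc.
apply: (@isomorphic_from (broom 3 #|T|) F Fb) => a b.
have Fx : x = F (inl (Ordinal (isT : 0 < 3))) by rewrite FE.
have Fy : y = F (inl (Ordinal (isT : 1 < 3))) by rewrite FE.
have Fc : c = F (inl (Ordinal (isT : 2 < 3))) by rewrite FE.
rewrite adjE Fx Fy Fc !(bij_eq Fb).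
case: a b => [[[|[|[|i]]] //= ?]|i] [[[|[|[|j]]] //= ?]|j] //.
Qed.

Lemma isomorphic_broom_at n : 3 <= n -> isomorphic T (broom 3 n) ->
  exists x y c, broom_at x y c [set: T].
Proof.
move=> n3 [f [g fK gK] fA].
pose v k (k3 : k < 3) := g (inl (Ordinal k3)).
have adjE (a b : broom 3 n) : adj (g a) (g b) = adj a b by rewrite -fA !gK.
have gE (a b : broom 3 n) : (g a == g b) = (a == b) by rewrite (can_eq gK).
exists (v 0 isT), (v 1 isT), (v 2 isT); rewrite /broom_at /v gE andbT.
apply/andP; split.
  apply: leafI; rewrite ?inE // ?adjE // => w _; rewrite -[w]fK adjE.
  case: (f w) => [[[|[|[|i]]] //= ?]|j] //= _; by congr (g (inl _)); apply: val_inj.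
apply/star_atP; split; first by rewrite !inE gE.
move=> u w; rewrite !inE -[u]fK -[w]fK !gE adjE !andbT.
by case: (f u) (f w) => [[[|[|[|i]]] //= ?]|i] [[[|[|[|j]]] //= ?]|j] //.
Qed.

Lemma Z1_setT : Z1 T = z1 [set: T].
Proof. by rewrite /z1 edges_in_setT. Qed.

End TreeGraphs.

Lemma Z1_isomorphic_broom (T : sgraph) n : 3 <= n -> #|T| = n -> isomorphic T (broom 3 n) ->
  Z1 T = (n - 3) ^ 2 + 1.
Proof.
move=> n3 Tn /(isomorphic_broom_at n3)[x [y [c B]]].
by rewrite Z1_setT (z1_broom B) cardsT Tn.
Qed.

Lemma Z1_broom n : 3 <= n -> Z1 (broom 3 n) = (n - 3) ^ 2 + 1.
Proof.
move=> n3; apply: Z1_isomorphic_broom => //.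
  by rewrite card_sum !card_ord subnKC.
by exists id => //; exists id.
Qed.

Theorem theorem4 (n : nat) (T : sgraph) :
  9 <= n -> is_tree T -> #|T| = n ->
  ~ isomorphic T (complete_bipartite 1 n.-1) ->
  Z1 (broom 3 n) <= Z1 T /\
  (Z1 T = Z1 (broom 3 n) <-> isomorphic T (broom 3 n)).
Proof.
move=> n9 treeT Tn nstar; have n3 : 3 <= n by apply: leq_trans n9.
rewrite (Z1_broom n3).
have tT := tree_on_setT treeT.
have nS : ~~ is_star [set: T].
  by apply/existsP => -[c /star_isomorphic]; rewrite Tn.
have [/existsP[x /existsP[y /existsP[c B]]]|nB] := boolP (is_broom [set: T]).
  have iso : isomorphic T (broom 3 n) by rewrite -Tn; apply: broom_isomorphic B.
  by rewrite (Z1_isomorphic_broom n3 Tn iso).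
have [_ /(_ nB)] := tree_bounds tT nS; rewrite -Z1_setT cardsT Tn => lb.
have {}lb := lb (leq_trans (isT : 7 < 9) n9).
split; first by lia.
by split=> [E|/(Z1_isomorphic_broom n3 Tn)//]; move: lb; rewrite E; lia.
Qed.
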